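(* Consider the projective splitting algorithm described in the context, under the stated assumptions. For all $k\ge2$ and $i=1,\ldots,n$, $$\varphi_{i,k}(z^k,w_i^k)-\frac{\rho_i^k}{2\alpha_i}\left(\|y_i^k-w_i^k\|^2+\alpha_i\|\hat y_i^k-w_i^k\|^2\right)\ge(1-\alpha_i)\left(\varphi_{i,k-1}(z^k,w_i^k)-\frac{\rho_i^k}{2\alpha_i}\|y_i^{k-1}-w_i^k\|^2\right)$$ and $$\varphi_{i,k}(z^k,w_i^k)-\frac{\rho_i^{k+1}}{2\alpha_i}\|y_i^k-w_i^k\|^2\ge(1-\alpha_i)\left(\varphi_{i,k-1}(z^k,w_i^k)-\frac{\rho_i^k}{2\alpha_i}\|y_i^{k-1}-w_i^k\|^2\right).$$
   Context: **Problem.** Let $n\ge 1$, let $\mathcal H_0=\mathcal H_n$ and $\mathcal H_1,\ldots,\mathcal H_{n-1}$ be real Hilbert spaces, and $\boldsymbol{\mathcal H}=\mathcal H_0\times\mathcal H_1\times\cdots\times\mathcal H_{n-1}$ with points $p=(z,\mathbf w)=(z,w_1,\ldots,w_{n-1})$ and the standard product inner product $\langle z^1,z^2\rangle+\sum_{i=1}^{n-1}\langle w_i^1,w_i^2\rangle$. Empty sums are $0$. For $i=1,\ldots,n$: $A_i:\mathcal H_i\to2^{\mathcal H_i}$ is maximal monotone; $B_i:\mathcal H_i\to\mathcal H_i$ is monotone, single-valued and everywhere defined, and either $L_i>0$ and $B_i$ is $L_i^{-1}$-cocoercive, i.e. $L_i\langle B_ix-B_ix',x-x'\rangle\ge\|B_ix-B_ix'\|^2$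 for all $x,x'$, or $L_i=0$ and $B_i$ is constant. $G_i:\mathcal H_0\to\mathcal H_i$ is linear and bounded, and $G_n=I$. Set $T_i=A_i+B_i$. The problem is to find $z$ with $0\in\sum_{i=1}^nG_i^*(A_i+B_i)G_iz$, assumed to have a solution, so that the set $\mathcal S=\{(z,w_1,\ldots,w_{n-1})\in\boldsymbol{\mathcal H}: w_i\in T_iG_iz\ (i=1,\ldots,n-1),\ -\sum_{i=1}^{n-1}G_i^*w_i\in T_nz\}$ is nonempty. $J_{\rho A}=(I+\rho A)^{-1}$ is the resolvent. **One-forward-step map.** For $\alpha\in[0,1]$, $\rho>0$, $\mathcal F_{\alpha,\rho}(z,x,w;A,B,G)=(x^+,y^+)$ with $t=(1-\alpha)x+\alpha Gz-\rho(Bx-w)$, $x^+=J_{\rho A}(t)$, $y^+=\rho^{-1}(t-x^+)+Bx^+$. **Parameters.** $\mathcal B\subseteq\{1,\ldots,n\}$ (indices with backtracking), $\gamma>0$, $\delta\in(0,1)$, $\hat\rho$; $(z^1,\mathbf w^1)\in\boldsymbol{\mathcal H}$; for every $i$: $x_i^0\in\mathcal H_i$, $0<\alpha_i\le1$, with $\alpha_i<1$ if $L_i>0$; for $i\in\mathcal B$: $\rho_i^0>0$, $\eta_i^0=0$, $\hat\theta_i\in\mathrm{dom}(A_i)$, $\hat w_i\in A_i\hat\theta_i+B_i\hat\theta_i$, $y_i^0\in A_ix_i^0+B_ix_i^0$; for $i\notin\mathcal B$: a fixed $\rho_i>0$ with $\rho_i\le2(1-\alpha_i)/L_i$ if $L_i>0$.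 Also $\hat\rho\ge\max\{\max_{i\in\mathcal B}\rho_i^0,\max_{i\notin\mathcal B}\rho_i\}$. Throughout $w_n^k=-\sum_{i=1}^{n-1}G_i^*w_i^k$. **Algorithm.** At each iteration $k=1,2,\ldots$: (1) For $i\in\mathcal B$ (backtracking): let $\varphi=\langle G_iz^k-x_i^{k-1},y_i^{k-1}-w_i^k\rangle$, $\bar\rho=\min\{(1+\alpha_i\eta_i^{k-1})\rho_i^{k-1},\hat\rho\}$, and choose any $\tilde\rho_1\in[\rho_i^{k-1},\bar\rho]$. For $j=1,2,\ldots$ compute $(\tilde x_j,\tilde y_j)=\mathcal F_{\alpha_i,\tilde\rho_j}(z^k,x_i^{k-1},w_i^k;A_i,B_i,G_i)$, $\hat y_j=\tilde\rho_j^{-1}((1-\alpha_i)x_i^{k-1}+\alpha_iG_iz^k-\tilde x_j)+w_i^k$, $\varphi_j^+=\langle G_iz^k-\tilde x_j,\tilde y_j-w_i^k\rangle$. If both $\|\tilde x_j-\hat\theta_i\|\le(1-\alpha_i)\|x_i^{k-1}-\hat\theta_i\|+\alpha_i\|G_iz^k-\hat\theta_i\|+\tilde\rho_j\|w_i^k-\hat w_i\|$ and $\varphi_j^+\ge\frac{\tilde\rho_j}{2\alpha_i}(\|\tilde y_j-w_i^k\|^2+\alpha_i\|\hat y_j-w_i^k\|^2)+(1-\alpha_i)(\varphi-\frac{\tilde\rho_j}{2\alpha_i}\|y_i^{k-1}-w_i^k\|^2)$ hold, stop backtracking and set $x_i^k=\tilde x_j$, $y_i^k=\tilde y_j$, $\rho_i^k=\tilde\rho_j$,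 $\eta_i^k=\|\hat y_j-w_i^k\|^2/\|\tilde y_j-w_i^k\|^2$ (any value in $[0,+\infty]$ if the denominator is $0$); otherwise set $\tilde\rho_{j+1}=\delta\tilde\rho_j$ and continue. (Backtracking always terminates finitely.) (2) For $i\notin\mathcal B$: $(x_i^k,y_i^k)=\mathcal F_{\alpha_i,\rho_i}(z^k,x_i^{k-1},w_i^k;A_i,B_i,G_i)$; write $\rho_i^k=\rho_i$ for all $k$. (3) Projection: $u_i=x_i^k-G_ix_n^k$ ($i=1,\ldots,n-1$), $v=\sum_{i=1}^{n-1}G_i^*y_i^k+y_n^k$, $\pi_k=\sum_{i=1}^{n-1}\|u_i\|^2+\gamma^{-1}\|v\|^2$. If $\pi_k=0$, set $z^{k+1}=x_n^k$, $w_i^{k+1}=y_i^k$ ($i\le n-1$) and terminate. Otherwise $\tau=\frac1{\pi_k}\max\{0,\langle z^k,v\rangle+\sum_{i=1}^{n-1}\langle w_i^k,u_i\rangle-\sum_{i=1}^n\langle x_i^k,y_i^k\rangle\}$, $z^{k+1}=z^k-\gamma^{-1}\tau v$, $w_i^{k+1}=w_i^k-\tau u_i$ ($i\le n-1$). Statements about iteration $k$ refer to iterations actually performed. **Notation.** $\varphi_{i,k}(z,w_i)=\langle G_iz-x_i^k,y_i^k-w_i\rangle$. $\hat y_i^k=a_i^k+B_ix_i^{k-1}$, where $a_i^k\in A_ix_i^k$ is defined by $x_i^k+\rho_i^ka_i^k=(1-\alpha_i)x_i^{k-1}+\alpha_iG_iz^k-\rho_i^k(B_ix_i^{k-1}-w_i^k)$.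 *)

(* Defs.v *)
(* MathComp / MathComp-Analysis, over an arbitrary [R : realType]. *)
From HB Require Import structures.
From mathcomp Require Import all_boot all_order all_algebra.
From mathcomp Require Import all_classical all_reals all_analysis.

Set Implicit Arguments.
Unset Strict Implicit.
Unset Printing Implicit Defensive.

Import Order.TTheory GRing.Theory Num.Theory.
Import numFieldNormedType.Exports.

Local Open Scope classical_set_scope.
Local Open Scope ring_scope.

HB.mixin Record NormedModule_isHilbert (R : realType) V
    of CompleteNormedModule R V := {
  inner : {dot V for @idfun R} ;
  sqr_norm_inner : forall x : V, `|x| ^+ 2 = inner x x
}.

#[short(type="hilbertType")]
HB.structure Definition Hilbert (R : realType) :=
  {V of CompleteNormedModule R V & NormedModule_isHilbert R V}.

Notation "''[' x , y ]" := (inner x y) : ring_scope.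

Section operators.
Context {R : realType}.
Implicit Types U V : hilbertType R.

(* A set-valued map [V -> 2^V] is a function [V -> set V]; [A x u] reads
   [u \in A x]. *)
Definition monotone_op V (A : V -> set V) : Prop :=
  forall x x' u u', A x u -> A x' u' -> 0 <= '[u - u', x - x'].

Definition maximal_monotone V (A : V -> set V) : Prop :=
  monotone_op A /\
  forall A' : V -> set V, monotone_op A' ->
    (forall x, A x `<=` A' x) -> forall x, A' x `<=` A x.

Definition cocoercive V (L : R) (B : V -> V) : Prop :=
  forall x x', `|B x - B x'| ^+ 2 <= L * '[B x - B x', x - x'].

(* [A + B], for a set-valued [A] and a single-valued [B]. *)
Definition add_op V (A : V -> set V) (B : V -> V) (x : V) : set V :=
  [set a + B x | a in A x].

(* [(I + rho A)^-1] as a set-valued map; when [A] is maximal monotone and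
   [rho > 0] its values are singletons (Minty), and [x = J_(rho A)(t)] is
   written [resolvent rho A t x]. *)
Definition resolvent V (rho : R) (A : V -> set V) (t : V) : set V :=
  [set x | [set x + rho *: a | a in A x] t].

(* When [G] is linear and bounded, the set below is a singleton by the Riesz
   representation theorem. *)
Definition adjoint U V (G : U -> V) (y : V) : U :=
  xget 0 [set v | forall x, '[G x, y] = '[x, v]].

Definition forward_arg U V (alpha rho : R) (z : U) (x w : V) (B : V -> V)
    (G : U -> V) : V :=
  (1 - alpha) *: x + alpha *: G z - rho *: (B x - w).

(* [is_forward_step alpha rho z x w A B G (x+, y+)] is
   [(x+, y+) = F_(alpha, rho)(z, x, w; A, B, G)]. *)
Definition is_forward_step U V (alpha rho : R) (z : U) (x w : V)
    (A : V -> set V) (B : V -> V) (G : U -> V) (xy : V * V) : Prop :=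
  let t := forward_arg alpha rho z x w B G in
  resolvent rho A t xy.1 /\ xy.2 = rho^-1 *: (t - xy.1) + B xy.1.

End operators.

(* The index set {1, ..., n}, n = m + 1, is encoded as ['I_m.+1], the index
   [n] being represented by [ord0] (recall that [H_0 = H_n]); the indices
   1, ..., n-1 are the [i != ord0]. *)
Record splitting_problem (R : realType) (m : nat) := SplittingProblem {
  sp_H : 'I_m.+1 -> hilbertType R ;
  sp_A : forall i, sp_H i -> set (sp_H i) ;
  sp_B : forall i, sp_H i -> sp_H i ;
  sp_L : 'I_m.+1 -> R ;
  sp_G : forall i, {linear sp_H ord0 -> sp_H i}
}.
Arguments sp_A {R m} _ _ _.
Arguments sp_B {R m} _ _ _.

Section algorithm.
Context {R : realType} {m : nat} (P : splitting_problem R m).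
Local Notation H := (sp_H P).
Local Notation A := (sp_A P).
Local Notation B := (sp_B P).
Local Notation L := (sp_L P).
Local Notation G := (sp_G P).
Local Notation T i := (add_op (A i) (B i)).

Definition has_solution : Prop :=
  exists (z : H ord0) (t : forall i, H i),
    (forall i, T i (G i z) (t i)) /\ \sum_i adjoint (G i) (t i) = 0.

Definition problem_assumptions : Prop :=
  [/\ forall i, maximal_monotone (A i),
      forall i, monotone_op (fun x => [set B i x]),
      forall i, (0 < L i /\ cocoercive (L i) (B i)) \/
                (L i = 0 /\ exists c, forall x, B i x = c),
      (forall i, bounded_near (G i) (nbhs (0 : H ord0))) /\
      (forall z, G ord0 z = z)
    & has_solution].

(* [par_rho i] is the initial stepsize rho_i^0 if [i] is a backtracking index,
   and the constant stepsize rho_i otherwise.  [par_theta] and [par_what] are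
   only relevant at backtracking indices. *)
Record parameters := AlgorithmParameters {
  par_bt : {set 'I_m.+1} ;
  par_gamma : R ;
  par_delta : R ;
  par_rhohat : R ;
  par_alpha : 'I_m.+1 -> R ;
  par_rho : 'I_m.+1 -> R ;
  par_theta : forall i, H i ;
  par_what : forall i, H i
}.

Definition parameter_assumptions (q : parameters) : Prop :=
  [/\ 0 < par_gamma q,
      0 < par_delta q < 1,
      forall i, 0 < par_alpha q i <= 1 /\ (0 < L i -> par_alpha q i < 1),
      forall i, 0 < par_rho q i <= par_rhohat q
    & (forall i, i \in par_bt q ->
         A i (par_theta q i) !=set0 /\ T i (par_theta q i) (par_what q i)) /\
      (forall i, i \notin par_bt q -> 0 < L i ->
         par_rho q i <= 2 * (1 - par_alpha q i) / L i)].

(* [run_w k ord0] is the dependent quantity [w_n^k] (see [is_run]). The values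
   [run_z 0], [run_w 0], and [run_y 0 i], [run_eta k i] for [i] not a
   backtracking index, as well as all values after termination, are
   irrelevant. *)
Record run := Run {
  run_z : nat -> H ord0 ;
  run_w : nat -> forall i, H i ;
  run_x : nat -> forall i, H i ;
  run_y : nat -> forall i, H i ;
  run_rho : nat -> 'I_m.+1 -> R ;
  run_eta : nat -> 'I_m.+1 -> \bar R
}.

Section steps.
Variables (q : parameters) (s : run).
Local Notation z := (run_z s).
Local Notation w := (run_w s).
Local Notation x := (run_x s).
Local Notation y := (run_y s).
Local Notation rho := (run_rho s).
Local Notation eta := (run_eta s).
Local Notation alpha := (par_alpha q).

(* [run_phi k i zz ww] is phi_{i,k}(zz, ww). *)
Definition run_phi (k : nat) (i : 'I_m.+1) (zz : H ord0) (ww : H i) : R :=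
  '[G i zz - x k i, y k i - ww].

Definition bt_yhat (k : nat) (i : 'I_m.+1) (rt : R) (xt : H i) : H i :=
  rt^-1 *: ((1 - alpha i) *: x k.-1 i + alpha i *: G i (z k) - xt) + w k i.

Definition bt_accept (k : nat) (i : 'I_m.+1) (rt : R) (xt yt : H i) : Prop :=
  let yh := bt_yhat k rt xt in
  let phi := run_phi k.-1 (z k) (w k i) in
  let phip := '[G i (z k) - xt, yt - w k i] in
  `|xt - par_theta q i| <=
    (1 - alpha i) * `|x k.-1 i - par_theta q i|
    + alpha i * `|G i (z k) - par_theta q i| + rt * `|w k i - par_what q i| /\
  phip >=
    rt / (2 * alpha i) * (`|yt - w k i| ^+ 2 + alpha i * `|yh - w k i| ^+ 2)
    + (1 - alpha i) * (phi - rt / (2 * alpha i) * `|y k.-1 i - w k i| ^+ 2).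

Definition bt_step (k : nat) (i : 'I_m.+1) : Prop :=
  let rhobar := mine ((1 + (alpha i)%:E * eta k.-1 i) * (rho k.-1 i)%:E)%E
                     (par_rhohat q)%:E in
  exists (J : nat) (rt : nat -> R) (xt yt : nat -> H i),
    (1 <= J)%N /\
    [/\ rho k.-1 i <= rt 1%N /\ ((rt 1%N)%:E <= rhobar)%E,
        forall j, (1 <= j <= J)%N ->
          is_forward_step (alpha i) (rt j) (z k) (x k.-1 i) (w k i)
            (A i) (B i) (G i) (xt j, yt j),
        forall j, (1 <= j < J)%N ->
          ~ bt_accept k (rt j) (xt j) (yt j) /\ rt j.+1 = par_delta q * rt j,
        bt_accept k (rt J) (xt J) (yt J)
      & [/\ x k i = xt J, y k i = yt J, rho k i = rt J
          & let yh := bt_yhat k (rt J) (xt J) in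
            (yt J - w k i = 0 -> (0 <= eta k i)%E) /\
            (yt J - w k i != 0 ->
             eta k i = (`|yh - w k i| ^+ 2 / `|yt J - w k i| ^+ 2)%:E)]].

Definition proj_u (k : nat) (i : 'I_m.+1) : H i := x k i - G i (x k ord0).

Definition proj_v (k : nat) : H ord0 :=
  \sum_(i | i != ord0) adjoint (G i) (y k i) + y k ord0.

Definition proj_pi (k : nat) : R :=
  \sum_(i | i != ord0) `|proj_u k i| ^+ 2
  + (par_gamma q)^-1 * `|proj_v k| ^+ 2.

Definition proj_tau (k : nat) : R :=
  (proj_pi k)^-1 *
  Num.max 0 ('[z k, proj_v k] + \sum_(i | i != ord0) '[w k i, proj_u k i]
             - \sum_i '[x k i, y k i]).

Definition proj_step (k : nat) : Prop :=
  if proj_pi k == 0 then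
    z k.+1 = x k ord0 /\ forall i, i != ord0 -> w k.+1 i = y k i
  else
    z k.+1 = z k - ((par_gamma q)^-1 * proj_tau k) *: proj_v k /\
    forall i, i != ord0 -> w k.+1 i = w k i - proj_tau k *: proj_u k i.

(* Iteration [k >= 1] is performed iff the algorithm has not terminated
   earlier. *)
Definition performed (k : nat) : Prop :=
  (1 <= k)%N /\ forall j, (1 <= j < k)%N -> proj_pi j != 0.

Definition is_run : Prop :=
  [/\ forall i, i \in par_bt q ->
        [/\ rho 0%N i = par_rho q i, eta 0%N i = 0%E
          & T i (x 0%N i) (y 0%N i)],
      forall k i, i \notin par_bt q -> rho k i = par_rho q i,
      forall k, w k ord0 = - \sum_(i | i != ord0) adjoint (G i) (w k i)
    & forall k, performed k ->
        [/\ forall i, i \in par_bt q -> bt_step k i,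
            forall i, i \notin par_bt q ->
              is_forward_step (alpha i) (rho k i) (z k) (x k.-1 i) (w k i)
                (A i) (B i) (G i) (x k i, y k i)
          & proj_step k]].

End steps.
End algorithm.

(* Main.v *)
Require Import Defs.
From mathcomp Require Import all_boot all_order all_algebra.
From mathcomp Require Import all_classical all_reals all_analysis.
From mathcomp Require Import ring.
Import Order.TTheory GRing.Theory Num.Theory.
Import numFieldNormedType.Exports.
Local Open Scope classical_set_scope.
Local Open Scope ring_scope.

(** Write [x], [x'] for two successive points of the block [i], [g] for
    [G_i z^k], [w] for [w_i^k], and measure the dual points from [w]: put
    [r = y - w] (old), [p = y' - w] (new) and [h = yhat - w].  All dual points
    come from the graph of [A_i]: [y] and [yhat] add [B_i x] to elements of
    [A_i x] and [A_i x'], while [y'] and [yhat] share the element of [A_i x']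
    but use [B_i x'] and [B_i x].  Hence
    - [h - r] is a difference of values of [A_i], and pairs nonnegatively with
      [d = x' - x] by monotonicity;
    - [p - h = B_i x' - B_i x], and cocoercivity together with the stepsize
      bound [rho <= 2 (1 - alpha) / L] gives
      [rho / 2 |p - h|^2 <= (1 - alpha) <p - h, d>].
    The definition of the step reads [alpha (g - x) = d + rho h], so that both
    [alpha <g - x', p>] and [alpha <g - x, r>] are expressed through [d], [h],
    [p] and [r]; the difference of the two sides of the first inequality, times
    [alpha], is then the sum of [(1 - alpha) (rho / 2) |h - r|^2], of
    [(1 - alpha) <h - r, d>], and of the slack in the cocoercivity estimate, all
    nonnegative ([relaxed_step_descent]).  This settles the first inequality for
    fixed stepsizes; the data of the previous iteration enter only through
    [(x, y)] lying in the graph of [T_i], which is why [k >= 2] is assumed.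
    With backtracking, the first inequality is the acceptance test itself.

    The second inequality follows from the first by
    [rho_{k+1} |p|^2 <= rho_k (|p|^2 + alpha |h|^2)].  For a fixed stepsize this
    is clear; with backtracking, a trial stepsize only decreases from a start
    which is at most [(1 + alpha eta_k) rho_k], and [eta_k |p|^2 = |h|^2] unless
    [p = 0] ([bt_step_growth]). *)

(** * Hilbert space inequalities *)

Lemma innerC {R : realType} {V : hilbertType R} (x y : V) : '[x, y] = '[y, x].
Proof. by rewrite hermC expr0 mul1r. Qed.

Lemma innerDl {R : realType} {V : hilbertType R} (x y z : V) :
  '[x + y, z] = '[x, z] + '[y, z].
Proof. exact: linearDl. Qed.

Lemma innerBl {R : realType} {V : hilbertType R} (x y z : V) :
  '[x - y, z] = '[x, z] - '[y, z].
Proof. exact: linearBl. Qed.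

Lemma innerBr {R : realType} {V : hilbertType R} (x y z : V) :
  '[z, x - y] = '[z, x] - '[z, y].
Proof. exact: linearBr. Qed.

Lemma innerZl {R : realType} {V : hilbertType R} (a : R) (x z : V) :
  '[a *: x, z] = a * '[x, z].
Proof. exact: linearZl_LR. Qed.

(** [alpha] times the difference of the two sides is
    [(1 - alpha) (rho / 2) |h - r|^2 + (1 - alpha) <h - r, d>
     + ((1 - alpha) <p - h, d> - rho / 2 |p - h|^2)]. *)
Lemma relaxed_step_descent {R : realType} {V : hilbertType R} {alpha rho : R}
    {e d h p r : V} :
  0 < alpha <= 1 -> 0 <= rho -> alpha *: e = d + rho *: h ->
  0 <= '[h - r, d] ->
  rho / 2 * `|p - h| ^+ 2 <= (1 - alpha) * '[p - h, d] ->
  (1 - alpha) * ('[e, r] - rho / (2 * alpha) * `|r| ^+ 2) <=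
  '[e - d, p] - rho / (2 * alpha) * (`|p| ^+ 2 + alpha * `|h| ^+ 2).
Proof.
move=> /andP[a0 a1] rho0 eE mono coco.
have aN0 : alpha != 0 by rewrite gt_eqF.
have -> : e = alpha^-1 *: (d + rho *: h) by rewrite -eE scalerK.
rewrite -subr_ge0 -(pmulr_rge0 _ a0).
have sq0 : 0 <= (1 - alpha) * (rho / 2) * `|h - r| ^+ 2.
  by rewrite !mulr_ge0 ?subr_ge0 ?invr_ge0 ?exprn_ge0.
have mono' : 0 <= (1 - alpha) * '[h - r, d] by rewrite mulr_ge0 ?subr_ge0.
rewrite -subr_ge0 in coco.
apply: le_trans (addr_ge0 (addr_ge0 sq0 mono') coco) _.
rewrite le_eqVlt; apply/orP; left; apply/eqP; rewrite !sqr_norm_inner.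
rewrite !(innerBl, innerBr, innerDl, innerZl).
rewrite (innerC p h) (innerC r h) (innerC p d) (innerC r d) (innerC h d).
by field.
Qed.

(** The stepsize bound says [rho L / 2 <= beta], and cocoercivity trades
    [|B x' - B x|^2] for [L <B x' - B x, x' - x>].  With [L = 0] the map is
    constant and both sides vanish. *)
Lemma cocoercive_stepsize {R : realType} {V : hilbertType R} {L rho beta : R}
    {B : V -> V} {x x' : V} :
  (0 < L /\ cocoercive L B) \/ (L = 0 /\ exists c, forall x, B x = c) ->
  (0 < L -> rho <= 2 * beta / L) -> 0 < rho ->
  rho / 2 * `|B x' - B x| ^+ 2 <= beta * '[B x' - B x, x' - x].
Proof.
case=> [[L0 coco] /(_ L0) rhoL rho0|[_ [c Bc]] _ _]; last first.
  by rewrite !Bc subrr normr0 expr0n linear0l !mulr0.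
have {}rhoL : rho * L / 2 <= beta.
  by move: rhoL; rewrite ler_pdivlMr// ler_pdivrMr// mulrC (mulrC beta).
have LI : 0 <= L * '[B x' - B x, x' - x].
  by apply: le_trans (coco x' x); rewrite exprn_ge0.
have I0 : 0 <= '[B x' - B x, x' - x] by rewrite -(pmulr_rge0 _ L0).
apply: (@le_trans _ _ (rho / 2 * (L * '[B x' - B x, x' - x]))).
  by apply: ler_wpM2l (coco _ _); rewrite divr_ge0// ltW.
by rewrite mulrA ler_wpM2r// mulrAC.
Qed.

(** * One forward step *)

Section forward_step.
Context {R : realType} {U V : hilbertType R}.
Context {alpha rho : R} {z : U} {w : V} {A : V -> set V} {B : V -> V}.
Context {G : U -> V}.
Hypothesis rho0 : 0 < rho.

Lemma forward_step_graph {x x' y' : V} :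
  is_forward_step alpha rho z x w A B G (x', y') ->
  exists2 a, A x' a &
    x' + rho *: a = forward_arg alpha rho z x w B G /\ y' = a + B x'.
Proof.
case=> /= -[a Aa aE] ->; exists a => //; split=> //.
by rewrite -aE addrAC subrr add0r scalerK// gt_eqF.
Qed.

(** Recovers the dual point [yhat = a + B x] from the primal points alone, as
    the backtracking procedure does. *)
Lemma forward_arg_dual {x x' a : V} :
  x' + rho *: a = forward_arg alpha rho z x w B G ->
  rho^-1 *: ((1 - alpha) *: x + alpha *: G z - x') + w = a + B x.
Proof.
have rhoN0 : rho != 0 by rewrite gt_eqF.
rewrite /forward_arg => aE; apply: (scalerI rhoN0).
rewrite scalerDr scalerA mulfV// scale1r.
have -> : (1 - alpha) *: x + alpha *: G z
    = x' + rho *: a + rho *: (B x - w) by rewrite aE subrK.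
by rewrite (addrAC _ _ (- x')) (addrAC x') subrr add0r -!scalerDr -addrA subrK.
Qed.

(** The relation [alpha (g - x) = d + rho h]. *)
Lemma forward_arg_displacement {x x' a : V} :
  x' + rho *: a = forward_arg alpha rho z x w B G ->
  alpha *: (G z - x) = (x' - x) + rho *: (a + B x - w).
Proof.
rewrite /forward_arg => aE.
rewrite -(addrA a) (scalerDr rho a) addrA (addrAC x') aE (addrAC _ (- x)) subrK.
rewrite scalerBl scale1r scalerBr addrAC (addrAC x) subrr add0r.
by rewrite addrC.
Qed.

(** The instance [h - r = a - a0], [p - h = B x' - B x] of
    [relaxed_step_descent]: the first difference is handled by monotonicity of
    [A], the second by cocoercivity of [B]. *)
Lemma forward_step_descent {L : R} {x x' a0 a : V} :
  0 < alpha <= 1 -> monotone_op A ->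
  (0 < L /\ cocoercive L B) \/ (L = 0 /\ exists c, forall x, B x = c) ->
  (0 < L -> rho <= 2 * (1 - alpha) / L) ->
  A x a0 -> A x' a -> x' + rho *: a = forward_arg alpha rho z x w B G ->
  (1 - alpha) * ('[G z - x, a0 + B x - w]
                 - rho / (2 * alpha) * `|a0 + B x - w| ^+ 2) <=
  '[G z - x', a + B x' - w]
  - rho / (2 * alpha) * (`|a + B x' - w| ^+ 2 + alpha * `|a + B x - w| ^+ 2).
Proof.
move=> a01 monoA cocoB rhoL Aa0 Aa aE.
have -> : G z - x' = (G z - x) - (x' - x) by rewrite opprB addrA subrK.
apply: relaxed_step_descent => //; first exact: ltW.
- exact: forward_arg_displacement.
- have -> : a + B x - w - (a0 + B x - w) = a - a0.
    by rewrite opprB addrA subrK opprD addrACA subrr addr0.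
  exact: monoA.
have -> : a + B x' - w - (a + B x - w) = B x' - B x.
  by rewrite opprB addrA subrK opprD addrACA subrr add0r.
exact: cocoercive_stepsize cocoB rhoL rho0.
Qed.

End forward_step.

(** * Stepsizes under backtracking *)

Section runs.
Context {R : realType} {m : nat} {P : splitting_problem R m}.
Context {q : parameters P} {s : run P} {i : 'I_m.+1}.
Local Notation alpha := (par_alpha q i).
Local Notation rho k := (run_rho s k i).

(** Trial stepsizes form a geometric sequence of ratio [delta < 1], so the
    accepted one is positive and at most the initial one, which the cap on the
    initial trial bounds. *)
Lemma bt_step_stepsize {k : nat} :
  0 < par_delta q < 1 -> 0 < rho k -> bt_step q s k.+1 i ->
  0 < rho k.+1 /\
  ((rho k.+1)%:E <= (1 + alpha%:E * run_eta s k i) * (rho k)%:E)%E.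
Proof.
move=> /andP[d0 d1] rho0 [J [rt [xt [yt [J1 []]]]]].
move=> [rt1 rtbar] _ shrink _ [_ _ -> _].
have rt10 : 0 < rt 1%N by exact: lt_le_trans rt1.
have rtP j : (1 <= j <= J)%N -> 0 < rt j <= rt 1%N.
  elim: j => [//|[_ _|j IHj /= jJ]]; first by rewrite rt10 lexx.
  have /andP[rtj0 rtj1] := IHj (ltnW jJ).
  have [_ ->] := shrink j.+1 jJ.
  rewrite mulr_gt0//=; apply: le_trans rtj1.
  by rewrite ger_pMl// ltW.
have /andP[-> rtJ] : 0 < rt J <= rt 1%N by apply: rtP; rewrite J1 leqnn.
split=> //; apply: (@le_trans _ _ (rt 1%N)%:E); first by rewrite lee_fin.
by apply: le_trans rtbar _; rewrite ge_min lexx.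
Qed.

(** The definition [eta |p|^2 = |h|^2] turns the cap on the next stepsize
    into the claim.  If [p = 0] then [eta] is arbitrary, even infinite, but then
    the left-hand side vanishes. *)
Lemma bt_step_growth {k : nat} :
  0 <= alpha -> 0 < rho k ->
  bt_step q s k i ->
  ((rho k.+1)%:E <= (1 + alpha%:E * run_eta s k i) * (rho k)%:E)%E ->
  rho k.+1 * `|run_y s k i - run_w s k i| ^+ 2 <=
  rho k * (`|run_y s k i - run_w s k i| ^+ 2
           + alpha * `|bt_yhat q s k (rho k) (run_x s k i) - run_w s k i| ^+ 2).
Proof.
move=> a0 rho0 [J [rt [xt [yt [_ [_ _ _ _ [xE yE rhoE [_ etaE]]]]]]]].
move: etaE; rewrite -xE -yE -rhoE.
have [->|pN0] := eqVneq (run_y s k i - run_w s k i) 0.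
  move=> _ _; rewrite normr0 expr0n mulr0 add0r.
  by rewrite !mulr_ge0 ?exprn_ge0// ltW.
have p0 : 0 < `|run_y s k i - run_w s k i| ^+ 2.
  by rewrite exprn_gt0 ?normr_gt0.
move=> /(_ isT) ->; rewrite -EFinM lee_fin => rhoS.
apply: le_trans (ler_wpM2r (ltW p0) rhoS) _.
rewrite le_eqVlt; apply/orP; left; apply/eqP; field.
by rewrite normr_eq0.
Qed.

Lemma performed_pred {k : nat} :
  (0 < k)%N -> performed q s k.+1 -> performed q s k.
Proof.
by move=> k0 [_ H]; split=> // j /andP[j1 jk]; apply: H; rewrite j1 ltnW.
Qed.

Lemma stepsize_gt0 {k : nat} :
  parameter_assumptions q -> is_run q s -> performed q s k -> 0 < rho k.
Proof.
move=> [_ d01 _ rhoP _] [init fixed _ step].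
have rho0 : 0 < par_rho q i by have /andP[] := rhoP i.
have [ibt|ibt] := boolP (i \in par_bt q); last by rewrite fixed.
elim: k => [[]//|k IHk hk].
have [/(_ i ibt) hbt _ _] := step _ hk.
have rhok0 : 0 < rho k.
  case: k IHk hk {hbt} => [|k] IHk hk; first by have [->] := init i ibt.
  exact: IHk (performed_pred (ltn0Sn _) hk).
by have [] := bt_step_stepsize d01 rhok0 hbt.
Qed.

End runs.

(** * The two inequalities *)

Theorem lemma17 (R : realType) (m : nat) (P : splitting_problem R m)
    (q : parameters P) (s : run P)
    (hP : problem_assumptions P) (hq : parameter_assumptions q)
    (hs : is_run q s) (k : nat) (hk2 : (2 <= k)%N) (hk : performed q s k)
    (i : 'I_m.+1) :
  let z := run_z s in
  let w := run_w s in
  let x := run_x s in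
  let y := run_y s in
  let rho := run_rho s in
  let alpha := par_alpha q in
  (forall a : sp_H P i,
     x k i + rho k i *: a =
       (1 - alpha i) *: x k.-1 i + alpha i *: sp_G P i (z k)
       - rho k i *: (sp_B P i (x k.-1 i) - w k i) ->
     let yhat := a + sp_B P i (x k.-1 i) in
     run_phi s k (z k) (w k i)
       - rho k i / (2 * alpha i)
         * (`|y k i - w k i| ^+ 2 + alpha i * `|yhat - w k i| ^+ 2)
     >= (1 - alpha i)
        * (run_phi s k.-1 (z k) (w k i)
           - rho k i / (2 * alpha i) * `|y k.-1 i - w k i| ^+ 2))
  /\
  (i \notin par_bt q \/ performed q s k.+1 ->
     run_phi s k (z k) (w k i)
       - rho k.+1 i / (2 * alpha i) * `|y k i - w k i| ^+ 2
     >= (1 - alpha i)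
        * (run_phi s k.-1 (z k) (w k i)
           - rho k i / (2 * alpha i) * `|y k.-1 i - w k i| ^+ 2)).
Proof.
move=> z w x y rho alpha.
have rho0 : 0 < rho k i by exact: (stepsize_gt0 hq hs hk).
have [monoA _ cocoB _ _] := hP.
have [_ d01 alphaP _ [_ rhoL]] := hq.
have [_ fixed _ step] := hs.
have a01 : 0 < alpha i <= 1 by have [] := alphaP i.
have /andP[a0 _] := a01.
pose yhat := bt_yhat q s k (rho k i) (x k i).
have yhatE a : x k i + rho k i *: a
    = forward_arg (alpha i) (rho k i) (z k) (x k.-1 i) (w k i) (sp_B P i)
        (sp_G P i) -> a + sp_B P i (x k.-1 i) = yhat.
  by move=> aE; rewrite /yhat /bt_yhat (forward_arg_dual rho0 aE).
have [step_bt step_fwd _] := step k hk.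
have descent : (1 - alpha i) * (run_phi s k.-1 (z k) (w k i)
           - rho k i / (2 * alpha i) * `|y k.-1 i - w k i| ^+ 2) <=
    run_phi s k (z k) (w k i) - rho k i / (2 * alpha i)
         * (`|y k i - w k i| ^+ 2 + alpha i * `|yhat - w k i| ^+ 2).
  have [ibt|ibt] := boolP (i \in par_bt q).
    have [J [rt [xt [yt [_ [_ _ _ [_ test] xyE]]]]]] := step_bt i ibt.
    have [xE yE rhoE _] := xyE.
    by rewrite lerBrDl /yhat /run_phi /x /y /rho xE yE rhoE.
  (* [y k.-1] lies in the graph of [T i] because iteration [k.-1] was a forward
     step. *)
  have hk' : performed q s k.-1.
    case: k hk2 hk {rho0 yhat yhatE step_bt step_fwd} => [//|[//|k]] _.
    exact: performed_pred.
  have rho0' : 0 < rho k.-1 i by exact: (stepsize_gt0 hq hs hk').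
  have [_ step_fwd' _] := step _ hk'.
  have [a' Aa' [_ yE']] := forward_step_graph rho0' (step_fwd' i ibt).
  have [a Aa [aE yE]] := forward_step_graph rho0 (step_fwd i ibt).
  rewrite -(yhatE a aE) /run_phi /y yE yE'.
  apply: (forward_step_descent rho0 a01 (proj1 (monoA i)) (cocoB i)) => //.
  by rewrite /rho fixed//; exact: rhoL.
split=> [a /yhatE -> //|later].
apply: le_trans descent _; rewrite lerD2l lerN2.
rewrite 2![_ / _]mulrC -2!mulrA ler_pM2l ?invr_gt0 ?mulr_gt0//.
have [ibt|ibt] := boolP (i \in par_bt q); last first.
  rewrite /rho !fixed// in rho0 *.
  by rewrite ler_pM2l// lerDl mulr_ge0 ?exprn_ge0// ltW.
have hkS : performed q s k.+1 by case: later => //; rewrite ibt.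
apply: bt_step_growth => //; [exact: ltW|exact: step_bt|].
have [/(_ i ibt) btS _ _] := step _ hkS.
by have [] := bt_step_stepsize d01 rho0 btS.
Qed.
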